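(* Let $K$ be a field of characteristic $0$. The $2\times4$ multiplicity matrix \[M=\begin{pmatrix}2&1&0&0\\1&0&1&0\end{pmatrix}\] is not the multiplicity matrix of a polynomial: there exist no polynomial $f(x)\in K[x]$ and no sequence $\Lambda=(\lambda_1,\lambda_2)$ of distinct elements of $K$ with $M=M_f(\Lambda)$.
   Context: For a polynomial $f$ of degree $d$ and a sequence $\Lambda=(\lambda_1,\ldots,\lambda_m)$ of distinct elements of $K$, the multiplicity matrix $M_f(\Lambda)$ is the $m\times(d+1)$ matrix (rows $i\in\{1,\ldots,m\}$, columns $j\in\{0,\ldots,d\}$) whose $(i,j)$ entry is the multiplicity of $\lambda_i$ as a zero of the $j$th derivative $f^{(j)}(x)$ (which is $0$ if $f^{(j)}(\lambda_i)\neq0$). *)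

(* Defs.v *)
From HB Require Import structures.
From mathcomp Require Import all_boot all_order all_algebra.

Set Implicit Arguments.
Unset Strict Implicit.
Unset Printing Implicit Defensive.

Import GRing.Theory.
Local Open Scope ring_scope.

(* M_f(Lambda) for f of degree d: [mup x p] is the multiplicity of x as a zero
   of p, and [f^`(j)] is the j-th formal derivative.  Meaningful only when
   [size f = d.+1]; see [is_multiplicity_matrix]. *)
Definition multiplicity_matrix (K : fieldType) (m d : nat) (f : {poly K})
    (Lambda : m.-tuple K) : 'M[nat]_(m, d.+1) :=
  \matrix_(i < m, j < d.+1) mup (tnth Lambda i) f^`(j).

(* M = M_f(Lambda).  M_f(Lambda) has deg f + 1 columns, so the equality carries
   the requirement deg f = d. *)
Definition is_multiplicity_matrix (K : fieldType) (m d : nat)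
    (M : 'M[nat]_(m, d.+1)) (f : {poly K}) (Lambda : m.-tuple K) : Prop :=
  size f = d.+1 /\ M = multiplicity_matrix d f Lambda.

Definition M_2100_1010 : 'M[nat]_(2, 4) :=
  \matrix_(i < 2, j < 4)
    nth 0%N (nth [::] [:: [:: 2; 1; 0; 0]%N;
                          [:: 1; 0; 1; 0]%N] i) j.

(* Main.v *)
Require Import Defs.
From mathcomp Require Import all_boot all_order all_algebra.

Import GRing.Theory.
Local Open Scope ring_scope.

(** The first column of the matrix and [deg f = 3] force
    [f = c (X - a)^2 (X - b)], whose second derivative takes the value
    [4 c (b - a)] at [b]; this is nonzero in characteristic 0, whereas the
    matrix requires [b] to be a zero of [f'']. *)

Lemma coprimep_prodr (R : idomainType) (I : Type) (r : seq I)
    (E : I -> {poly R}) (p : {poly R}) :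
  coprimep p (\prod_(i <- r) E i) = all (fun i => coprimep p (E i)) r.
Proof.
elim: r => [|i r IHr] /=; first by rewrite big_nil coprimep1.
by rewrite big_cons coprimepMr IHr.
Qed.

Lemma Gauss_dvdp_prod (R : idomainType) (I : Type) (r : seq I)
    (E : I -> {poly R}) (p : {poly R}) :
    pairwise [rel i j | coprimep (E i) (E j)] r ->
  (\prod_(i <- r) E i %| p) = all (fun i => E i %| p) r.
Proof.
elim: r => [|i r IHr] /=; first by rewrite big_nil dvd1p.
case/andP=> coEi coEr.
by rewrite big_cons Gauss_dvdp ?IHr // coprimep_prodr.
Qed.

Lemma all_mup_prod_XsubC (F : fieldType) (I : finType) (x : I -> F)
    (n : I -> nat) (p : {poly F}) :
    injective x -> size p = (\sum_i n i).+1 ->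
    (forall i, (n i <= mup (x i) p)%N) ->
  p = lead_coef p *: \prod_i ('X - (x i)%:P) ^+ n i.
Proof.
move=> x_inj size_p le_n_mup; have p0 : p != 0 by rewrite -size_poly_eq0 size_p.
set q := \prod_i _.
have q_monic : q \is monic.
  by apply: monic_prod => i _; rewrite monic_exp ?monicXsubC.
have size_q : size q = (\sum_i n i).+1.
  rewrite /q size_prod => [|i _]; last by rewrite expf_neq0 ?polyXsubC_eq0.
  under eq_bigr do rewrite size_exp_XsubC -addn1.
  by rewrite big_split /= sum1_card -addSn addnK.
have q_dvd_p : q %| p.
  rewrite Gauss_dvdp_prod; first by apply/allP=> i _; rewrite -mup_geq.
  have := index_enum_uniq I; rewrite uniq_pairwise.
  apply: sub_pairwise => i j /= neq_ij.
  rewrite coprimep_expl // coprimep_expr // coprimep_XsubC root_XsubC.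
  by rewrite (inj_eq x_inj) eq_sym.
have /eqp_eq : q %= p by rewrite -dvdp_size_eqp // size_q size_p.
by rewrite (monicP q_monic) scale1r.
Qed.

Lemma derivn_exp_XsubC (R : comNzRingType) (a : R) n k :
  (('X - a%:P) ^+ n)^`(k) = ('X - a%:P) ^+ (n - k) *+ n ^_ k.
Proof.
elim: k => [|k IHk]; first by rewrite derivn0 subn0 ffactn0.
rewrite derivnS IHk derivMn deriv_exp derivXsubC mul1r -mulrnA mulnC.
by rewrite -ffactnSr subnS.
Qed.

Lemma derivnMXsubC (R : nzRingType) (p : {poly R}) (b : R) k :
  (p * ('X - b%:P))^`(k.+1) = p^`(k) *+ k.+1 + p^`(k.+1) * ('X - b%:P).
Proof.
elim: k => [|k IHk]; first by rewrite !derivn1 derivM derivXsubC mulr1 addrC.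
rewrite derivnS IHk derivD derivMn derivM derivXsubC mulr1 -!derivnS.
by rewrite addrCA addrC -mulrSr.
Qed.

Lemma horner_derivn_exp_XsubC_mul (R : comNzRingType) (a b : R) n k :
  (('X - a%:P) ^+ n * ('X - b%:P))^`(k.+1).[b]
    = (b - a) ^+ (n - k) *+ (n ^_ k * k.+1).
Proof.
rewrite derivnMXsubC derivn_exp_XsubC -mulrnA hornerD hornerM hornerMn.
by rewrite horner_exp !hornerXsubC subrr mulr0 addr0.
Qed.

Theorem theorem8 (K : fieldType) (charK0 : [pchar K] =i pred0) :
  ~ exists (f : {poly K}) (Lambda : 2.-tuple K),
      uniq Lambda /\ is_multiplicity_matrix M_2100_1010 f Lambda.
Proof.
move=> [f [L [uniq_L [size_f M_eq]]]].
have mupE i (j : 'I_4) : mup (tnth L i) f^`(j) = M_2100_1010 i j.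
  by rewrite M_eq mxE.
set a := tnth L ord0; set b := tnth L ord_max.
have neq_ba : b != a by rewrite (inj_eq (tuple_uniqP _ uniq_L)).
have fE : f = lead_coef f *: (('X - a%:P) ^+ 2 * ('X - b%:P)).
  rewrite [LHS](@all_mup_prod_XsubC _ _ (tnth L) (M_2100_1010 ^~ ord0)).
  - by rewrite big_ord_recl big_ord1 !mxE /a /b !(tnth_nth 0).
  - exact/tuple_uniqP.
  - by rewrite big_ord_recl big_ord1 !mxE.
  - by move=> i; rewrite -mupE derivn0.
have f''b_neq0 : ~~ root f^`(2) b.
  rewrite /root fE derivnZ hornerZ horner_derivn_exp_XsubC_mul -mulr_natr.
  rewrite !mulf_neq0 ?expf_neq0 ?subr_eq0 ?(pcharf0P K).1 //.
  by rewrite lead_coef_eq0 -size_poly_eq0 size_f.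
have := mupE ord_max (Ordinal (isT : (2 < 4)%N)).
by rewrite mupNroot // mxE.
Qed.
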